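(* Let $N\in\mathbb{N}$ and $\chi=\{0,\dots,N-1\}$ with the operation $x\oplus y=\max\{x,y\}$. Then any random variable $\xi$ taking values in $\chi$ is infinitely divisible.
   Context: A random variable $\xi$ taking values in $\chi$ is called infinitely divisible (with respect to $\oplus=\max$) if for every $n\in\mathbb{N}$ there exists a random variable $X^{(n)}$ taking values in $\chi$ such that $\xi$ has the same distribution as $X^{(n)}_1\oplus\cdots\oplus X^{(n)}_n=\max_{k=1,\dots,n}X^{(n)}_k$, where $X^{(n)}_1,\dots,X^{(n)}_n$ are independent copies of $X^{(n)}$. *)

(* Defs.v *)
From HB Require Import structures.
From mathcomp Require Import all_boot all_order all_algebra.
From mathcomp Require Import all_classical all_reals all_analysis.

Set Implicit Arguments.
Unset Strict Implicit.
Unset Printing Implicit Defensive.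

Local Open Scope classical_set_scope.
Local Open Scope ereal_scope.

Definition mutually_independent d d' (T : measurableType d)
    (T' : measurableType d') (R : realType) (P : probability T R)
    (I : finType) (X : I -> {RV P >-> T'}) : Prop :=
  forall (J : {set I}) (A : I -> set T'), (forall i, measurable (A i)) ->
    P (\bigcap_(i in [set` J]) (X i @^-1` A i)) =
    \prod_(i in J) P (X i @^-1` A i).

(* A random variable with values in a set [chi] of naturals is a random
   variable into [nat], whose sigma-algebra is discrete, with range included
   in [chi]. *)
(* The variable [X] and its copies [Xs] are not required to live on the
   probability space of [xi], which may be too small to carry them. *)
Definition infinitely_divisible (chi : set nat) d (T : measurableType d)
    (R : realType) (P : probability T R) (xi : {RV P >-> nat}) : Prop :=
  forall n : nat, (0 < n)%N ->
  exists (d1 : measure_display) (T1 : measurableType d1)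
    (P1 : probability T1 R) (X : {RV P1 >-> nat}),
    range X `<=` chi /\
    exists (d2 : measure_display) (T2 : measurableType d2)
      (P2 : probability T2 R) (Xs : 'I_n -> {RV P2 >-> nat}),
      [/\ forall k, range (Xs k) `<=` chi,
          mutually_independent Xs,
          forall k, distribution P2 (Xs k) = distribution P1 X :> (set nat -> \bar R)
        & distribution P xi =
          pushforward P2 (fun w => (\max_(k < n) Xs k w)%N) :> (set nat -> \bar R)].

(* Main.v *)
Require Import Defs.
From HB Require Import structures.
From mathcomp Require Import all_boot all_order all_algebra.
From mathcomp Require Import all_classical all_reals all_analysis.

Set Implicit Arguments.
Unset Strict Implicit.
Unset Printing Implicit Defensive.

Local Open Scope classical_set_scope.

(** Write [F m] for the probability that [xi < m].  The function [F `^ n^-1] is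
    again nondecreasing, vanishes at 0 and equals 1 from [N] on, so its
    increments [p k] are the point masses of a probability [q] on
    {0, ..., N-1} whose distribution function is the [n]-th root of [F].  The
    finite product space of [n] copies of [q] (lemma [iid_family]) carries [n]
    independent variables of law [q], and their maximum is below [m] exactly
    when all of them are, which has probability [(F m `^ n^-1) ^+ n = F m].
    A probability on [nat] is determined by its values on initial segments
    (lemma [nat_probability_eq]), so the maximum has the law of [xi]. *)

Import Order.TTheory GRing.Theory Num.Theory.
Local Open Scope ring_scope.

(** The finite sum of Dirac masses at the points [a i], not necessarily
    distinct, with weights [w i]. *)
Lemma finite_atomic_probability (R : realType) d (T : measurableType d)
    (I : finType) (a : I -> T) (w : I -> R) :
  (forall i, 0 <= w i) -> \sum_i w i = 1 ->
  exists P : probability T R,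
    forall A, P A = (\sum_i w i * \1_A (a i))%:E.
Proof.
move=> w0 w1.
have [i0 _] : exists i0 : I, true.
  case: (pickP (fun _ : I => true)) => [i _|I0]; first by exists i.
  by move: w1; rewrite big_pred0 // => /esym/eqP; rewrite oner_eq0.
pose m (k : nat) : {measure set T -> \bar R} :=
  mscale (NngNum (w0 (nth i0 (enum I) k))) (dirac (a (nth i0 (enum I) k))).
pose mu : {measure set T -> \bar R} := msum m #|I|.
have muE A : mu A = (\sum_i w i * \1_A (a i))%:E.
  rewrite /mu/= /msum -sumEFin -[RHS]big_enum (big_nth i0) big_mkord -cardE.
  by apply: eq_bigr => k _; rewrite /m/= /mscale/= diracE indicE EFinM.
have mu1 : mu setT = 1%E.
  by rewrite muE -w1; congr EFin; apply: eq_bigr => i _; rewrite indicT mulr1.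
pose P : probability T R :=
  HB.pack (Measure.sort mu) (Measure_isProbability.Build _ _ _ mu mu1).
by exists P.
Qed.

(** The sample space: the words of length [n] over an alphabet of [N.+1]
    letters, with the discrete sigma-algebra.  The alphabet is nonempty because
    measurable types are pointed. *)
Definition word (n N : nat) : Type := {ffun 'I_n -> 'I_N.+1}.

HB.instance Definition _ n N := Finite.on (word n N).
HB.instance Definition _ n N :=
  isPointed.Build (word n N) [ffun _ => ord0].
HB.instance Definition _ n N := isMeasurable.Build default_measure_display
  (word n N) (@discrete_measurable0 _) (@discrete_measurableC _)
  (@discrete_measurableU _).

(** The letters are seen as numbers, so that each position gives a random
    variable with values in [nat]. *)
Definition letter n N (i : 'I_n) (f : word n N) : nat :=
  (f : {ffun 'I_n -> 'I_N.+1}) i.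

Lemma measurable_word n N d (T : measurableType d) (X : word n N -> T) :
  measurable_fun [set: word n N] X.
Proof. by []. Qed.

HB.instance Definition _ n N i :=
  isMeasurableFun.Build _ _ (word n N) nat (@letter n N i) (measurable_word _).

Definition max_letter n N (f : word n N) : nat := (\max_(i < n) letter i f)%N.

HB.instance Definition _ n N :=
  isMeasurableFun.Build _ _ (word n N) nat (@max_letter n N)
    (measurable_word _).

(** The total weight of the letters in [A]: the one-letter law with point masses
    [p], as a real number. *)
Definition letter_law (R : realType) N (p : 'I_N.+1 -> R) (A : set nat) : R :=
  \sum_k p k * \1_A (k : nat).

(** The words whose [i]-th letter lies in [B i] for every [i]. *)
Definition box n N (B : 'I_n -> set nat) : set (word n N) :=
  [set f | forall i, B i (letter i f)].

(** Independent, identically distributed letters: under the product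
    probability, the mass of a box is the product of the masses of its sides.
    This is the distributivity of a product of sums over choice functions. *)
Lemma iid_family (R : realType) n N (p : 'I_N.+1 -> R) :
  (forall k, 0 <= p k) -> \sum_k p k = 1 ->
  exists Q : probability (word n N) R,
    forall B, Q (box B) = (\prod_i letter_law p (B i))%:E.
Proof.
move=> p0 p1.
pose w (f : word n N) : R := \prod_i p ((f : {ffun 'I_n -> 'I_N.+1}) i).
have w0 f : 0 <= w f by apply: prodr_ge0.
have w1 : \sum_f w f = 1.
  rewrite -(bigA_distr_bigA (fun (_ : 'I_n) k => p k)) /=.
  by rewrite big1.
have [Q QE] := @finite_atomic_probability R _ (word n N) _ id w w0 w1.
exists Q => B; rewrite QE; congr EFin.
rewrite /letter_law bigA_distr_bigA /=; apply: eq_bigr => f _.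
rewrite big_split /=; congr (_ * _).
rewrite indicE; have [/set_mem fB|] := boolP (f \in box B).
  by rewrite big1// => i _; rewrite indicE mem_set//; exact: fB.
move=> /negP fB.
have [i Bi] : exists i, ~ B i (letter i f).
  by apply/existsNP => fB'; apply: fB; rewrite inE.
by rewrite (bigD1 i)//= indicE memNset ?mul0r.
Qed.

(** A probability on [nat] is determined by its values on initial segments:
    differences give the points, and countable additivity the rest. *)
Lemma nat_probability_eq (R : realType) (P Q : probability nat R) :
  (forall m, P `I_m = Q `I_m) -> forall A, P A = Q A.
Proof.
move=> PQ.
have split1 (M : probability nat R) k : M `I_k.+1 = (M `I_k + M [set k])%E.
  rewrite -measureU//; first by rewrite IIS.
  by apply/seteqP; split => // x [/= + xk]; rewrite xk ltnn.
have PQ1 k : P [set k] = Q [set k].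
  have := PQ k.+1; rewrite !split1 PQ => PQk.
  rewrite -(@addeK _ (Q `I_k) (P [set k])) ?fin_num_measure//.
  by rewrite (addeC (P [set k])) PQk (addeC (Q `I_k)) addeK ?fin_num_measure.
move=> A; have -> : A = \bigcup_(k in A) [set k].
  by rewrite bigcup_imset1 image_id.
have A1 : trivIset A (fun k : nat => [set k]).
  by move=> i j _ _ [x [/= -> ->]].
by rewrite !measure_bigcup//; apply: eq_eseriesr => k _; exact: PQ1.
Qed.

Lemma telescope_indic (R : nzRingType) (G : nat -> R) N m :
  \sum_(k < N) ((G k.+1 - G k) * \1_(`I_m) (k : nat)) =
    G (minn N m) - G 0.
Proof.
elim: N => [|N IH]; first by rewrite big_ord0 min0n subrr.
rewrite big_ord_recr /= IH indicE.
have [Nm|mN] := ltnP N m.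
  rewrite mem_set// mulr1 (minn_idPl Nm).
  by rewrite addrC addrA subrK.
rewrite memNset ?mulr0 ?addr0 ?(minn_idPr (leqW mN))//.
by rewrite /= ltnNge mN.
Qed.

(** A sequence equal to 0 at 0 and to 1 from [N.+1] on gives the masses of the
    initial segments for the point masses that are its increments.  These may
    be negative here. *)
Lemma letter_law_increments (R : realType) N (G : nat -> R) :
  G 0 = 0 -> (forall m, (N < m)%N -> G m = 1) ->
  let p (k : 'I_N.+1) := G k.+1 - G k in
  forall m, letter_law p `I_m = G m.
Proof.
move=> G0 G1 p m; rewrite /letter_law telescope_indic G0 subr0.
by have [//|Nm] := leqP m N.+1; rewrite !G1// ltnW.
Qed.

Theorem mainTheorem7 (R : realType) (N : nat) (d : measure_display)
    (T : measurableType d) (P : probability T R) (xi : {RV P >-> nat})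
    (xi_chi : range xi `<=` `I_N) :
  infinitely_divisible `I_N xi.
Proof.
move=> n n0.
(* The range of [xi] is nonempty, so [N] is a successor. *)
have {N xi_chi} [N -> xi_chi] : exists2 M, N = M.+1 & range xi `<=` `I_M.+1.
  case: N xi_chi => [xi0|M]; last by exists M.
  by have /= := xi0 (xi point) (ex_intro2 _ _ point I erefl).
pose F m : R := fine (distribution P xi `I_m).
have FE m : distribution P xi `I_m = (F m)%:E.
  by rewrite fineK// fin_num_measure.
have F0 : F 0 = 0 by rewrite /F II0 measure0.
have F_ge0 m : 0 <= F m by rewrite fine_ge0.
have F_nd k : F k <= F k.+1.
  rewrite -lee_fin -!FE; apply: le_measure; rewrite ?inE//.
  by move=> x /= /leqW.
have F1 m : (N < m)%N -> F m = 1.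
  move=> Nm; apply: EFin_inj; rewrite -FE -[RHS](probability_setT P).
  congr (P _); apply/seteqP; split=> // t _ /=.
  by apply: leq_trans Nm; apply: xi_chi; exists t.
pose G m : R := F m `^ n%:R^-1.
have nR0 : n%:R^-1 != 0 :> R by rewrite invr_eq0 pnatr_eq0 -lt0n.
have GX m : G m ^+ n = F m.
  rewrite -powR_mulrn ?powR_ge0// -powRrM mulVf ?powRr1//.
  by rewrite pnatr_eq0 -lt0n.
have G0 : G 0 = 0 by rewrite /G F0 powR0.
have G1 m : (N < m)%N -> G m = 1 by move=> /F1 Fm; rewrite /G Fm powR1.
pose p (k : 'I_N.+1) : R := G k.+1 - G k.
have p0 k : 0 <= p k.
  by rewrite subr_ge0 ge0_ler_powR ?nnegrE ?invr_ge0.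
have lawT : letter_law p setT = \sum_k p k.
  by apply: eq_bigr => k _; rewrite indicT mulr1.
have lawI m : letter_law p `I_m = G m by exact: letter_law_increments.
have p1 : \sum_k p k = 1.
  rewrite -(G1 N.+1)// -lawI; apply: eq_bigr => k _.
  by rewrite indicE mem_set ?mulr1//=.
have [Q QE] := @iid_family R n N p p0 p1.
(* An event bearing only on the letters in [J] is a box with trivial other
   sides. *)
have QJ (J : {set 'I_n}) (A : 'I_n -> set nat) :
    Q (\bigcap_(i in [set` J]) (@letter n N i @^-1` A i)) =
    (\prod_(i in J) letter_law p (A i))%:E.
  rewrite (_ : \bigcap_(i in _) _ =
      box (fun i => if i \in J then A i else setT)).
    rewrite QE; congr EFin; rewrite [RHS]big_mkcond /=.
    by apply: eq_bigr => i _; case: ifP => // _; rewrite lawT.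
  apply/seteqP; split => f /= fA i; first by case: ifPn => // /fA.
  by move=> iJ; have := fA i; rewrite iJ.
have Q1 i (A : set nat) : Q (@letter n N i @^-1` A) = (letter_law p A)%:E.
  have := QJ [set i]%SET (fun=> A); rewrite big_set1 => <-.
  congr (Q _); apply/seteqP; split => [f fA j /=|f /(_ i)/=].
    by rewrite inE => /eqP ->.
  by rewrite inE; apply.
pose X i : {RV Q >-> nat} := @letter n N i.
have X_chi i : range (X i) `<=` `I_N.+1 by move=> _ [f _ <-] /=; exact: ltn_ord.
exists _, (word n N), Q, (X (Ordinal n0)); split => //.
exists _, (word n N), Q, X; split => //.
- move=> J A _; rewrite QJ -prodEFin; apply: eq_bigr => i _.
  exact/esym/Q1.
- by move=> k; apply/funext => A; rewrite [LHS](Q1 k) [RHS](Q1 (Ordinal n0)).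
apply/funext => A.
apply: (@nat_probability_eq R (distribution P xi)
  (distribution Q (@max_letter n N))).
move=> m; transitivity (F m)%:E; first exact: FE.
rewrite -[RHS]/(Q (@max_letter n N @^-1` `I_m)).
(* A maximum of letters is at most [m] exactly when all of them are; this
   covers every initial segment but the empty one. *)
case: m => [|m]; first by rewrite II0 preimage_set0 measure0 F0.
rewrite (_ : _ @^-1` _ = box (fun=> `I_m.+1)).
  by rewrite QE lawI prodr_const card_ord GX.
apply/seteqP; split => f /= fm.
  move=> i; apply: leq_ltn_trans fm.
  exact: (leq_bigmax (F := fun j => letter j f) i).
by rewrite ltnS; apply/bigmax_leqP => i _; have := fm i.
Qed.
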